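(* Let $E=\mathrm{diag}(\alpha_1,\dots,\alpha_N)$ with all $\alpha_j>0$, let $\lambda_{\min}:=\min_j\alpha_j$ and $|E|:=\mathrm{tr}(E)=\sum_{j=1}^N\alpha_j$. Let $\mathbf{w}\in L^1_{\mathrm{loc}}(\mathbb{R}^N)$ be nonnegative, and suppose that the operator mass $$F^E(R):=\int_{\Pi_R}\mathbf{w}(x)\,dx,\qquad \Pi_R:=\{x\in\mathbb{R}^N:\ |x_j|\le R^{\alpha_j}\ (1\le j\le N)\},$$ satisfies $F^E\in\mathrm{RV}_{\gamma_E}$, $F^E(R)=R^{\gamma_E}L(R)$ with $L\in\mathrm{RV}_0$, for some $\gamma_E\in(0,|E|)$. Set $q:=|E|-\gamma_E\in(0,|E|)$ and $$p_F^E:=\begin{cases}\dfrac{q}{q-2\lambda_{\min}}, & q>2\lambda_{\min},\\[6pt]\infty,& q\le 2\lambda_{\min}.\end{cases}$$ Then the problem $$\partial_t u-\Delta u=|u|^p+\mathbf{w}(x)\ \text{ in }(0,\infty)\times\mathbb{R}^N,\qquad u(0,\cdot)=u_0,$$ admits no global weak solution for $1<p<p_F^E$. If, in addition, $q>2\lambda_{\min}$ and $L(R)\to\infty$ as $R\to\infty$, then nonexistence of global weak solutions also holds at the critical exponent $p=p_F^E$.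
   Context: Regular variation: a measurable function $V:[A,\infty)\to(0,\infty)$, $A>0$, belongs to $\mathrm{RV}_\rho$ ($\rho\in\mathbb{R}$) if $\lim_{t\to\infty}V(tx)/V(t)=x^\rho$ for every $x>0$. Global weak solution: let $p>1$, $u_0\in L^1_{\mathrm{loc}}(\mathbb{R}^N)$, $u_0\ge 0$, $\mathbf{w}\in L^1_{\mathrm{loc}}(\mathbb{R}^N)$. A global weak solution of the problem is a function $u\in L^p_{\mathrm{loc}}([0,\infty)\times\mathbb{R}^N)$, $u\ge0$ a.e., such that $$\int_0^T\!\!\int_{\mathbb{R}^N}(|u|^p+\mathbf{w})\varphi\,dx\,dt+\int_{\mathbb{R}^N}u_0\,\varphi(0,x)\,dx=-\int_0^T\!\!\int_{\mathbb{R}^N}u\,\partial_t\varphi\,dx\,dt-\int_0^T\!\!\int_{\mathbb{R}^N}u\,\Delta\varphi\,dx\,dt$$ for every $T>0$ and every nonnegative $\varphi\in C^{1,2}([0,T]\times\mathbb{R}^N)$ (once continuously differentiable in time, twice in space) which is compactly supported in space and satisfies $\varphi(T,\cdot)\equiv0$. ''Admits no global weak solution'' means that none exists for any such $u_0$. *)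

(* Defs.v *)
From HB Require Import structures.
From mathcomp Require Import all_boot all_order all_algebra.
From mathcomp Require Import all_classical all_reals all_analysis.

Set Implicit Arguments.
Unset Strict Implicit.
Unset Printing Implicit Defensive.

Import Order.TTheory GRing.Theory Num.Theory.
Import numFieldNormedType.Exports.

Local Open Scope classical_set_scope.
Local Open Scope ring_scope.

(* Row vectors carry the product sigma-algebra, as [n.-tuple T] does in the
   library; for a real type it is the Borel sigma-algebra of R^n. *)
Definition measure_row_display : measure_display -> measure_display.
Proof. exact. Qed.

Section measurable_row.
Context {d} {T : sigmaRingType d}.
Variable n : nat.

Let coors : 'I_n -> 'rV[T]_n -> T := fun i x => x 0 i.

Let row_set0 : g_sigma_preimage coors set0.
Proof. exact: sigma_algebra0. Qed.

Let row_setC A : g_sigma_preimage coors A -> g_sigma_preimage coors (~` A).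
Proof. exact: sigma_algebraC. Qed.

Let row_bigcup (F : _^nat) : (forall i, g_sigma_preimage coors (F i)) ->
  g_sigma_preimage coors (\bigcup_i (F i)).
Proof. exact: sigma_algebra_bigcup. Qed.

HB.instance Definition _ := @isMeasurable.Build (measure_row_display d)
  'rV[T]_n (g_sigma_preimage coors) row_set0 row_setC row_bigcup.

End measurable_row.

Section measurable_row_fun.
Context d1 d2 (T1 : measurableType d1) (T2 : measurableType d2).

Lemma measurable_coord n (i : 'I_n) :
  measurable_fun [set: 'rV[T2]_n] (fun x : 'rV[T2]_n => x 0 i).
Proof.
move=> _ Y mY; rewrite setTI; apply: sub_sigma_algebra => /=.
rewrite -bigcup_seq/=; exists i => /=; first by rewrite mem_index_enum.
by exists Y => //; rewrite setTI.
Qed.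

Lemma measurable_fun_rowP n (f : T1 -> 'rV[T2]_n) :
  measurable_fun [set: T1] f <->
  forall i, measurable_fun [set: T1] (fun t => f t 0 i).
Proof.
split=> [mf i|mf].
  exact: (measurableT_comp (measurable_coord i) mf).
move=> _ Y; rewrite setTI; move: Y.
suff H : preimage_set_system [set: T1] f
    (g_sigma_preimage (fun i (x : 'rV[T2]_n) => x 0 i)) `<=` measurable.
  by move=> Y mY; apply: H; exists Y => //; rewrite setTI.
rewrite /g_sigma_preimage -g_sigma_preimageE.
apply: smallest_sub; first exact: sigma_algebra_measurable.
move=> _ [B + <-]; rewrite -bigcup_seq => -[i _ [A mA <-]].
by rewrite !setTI -[X in measurable X]setTI; exact: mf.
Qed.

End measurable_row_fun.

Section lebesgue_measure_row.
Context {R : realType}.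
Local Open Scope ereal_scope.

Definition cons_row n (z : measurableTypeR R * 'rV[R]_n) : 'rV[R]_(1 + n) :=
  row_mx (z.1)%:M%R z.2.

Lemma cons_row0 n (z : measurableTypeR R * 'rV[R]_n) :
  cons_row z ord0 (ord0 : 'I_n.+1) = z.1.
Proof.
rewrite (_ : (ord0 : 'I_n.+1) = lshift n (ord0 : 'I_1)); last exact/val_inj.
by rewrite /cons_row row_mxEl mxE eqxx mulr1n.
Qed.

Lemma cons_rowS n (z : measurableTypeR R * 'rV[R]_n) (i : 'I_n) :
  cons_row z ord0 (lift (ord0 : 'I_n.+1) i) = z.2 ord0 i.
Proof.
rewrite (_ : lift (ord0 : 'I_n.+1) i = rshift 1 i); last exact/val_inj.
by rewrite /cons_row row_mxEr.
Qed.

Lemma measurable_cons_row n : measurable_fun setT (@cons_row n).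
Proof.
apply/measurable_fun_rowP => i; case: (unliftP (ord0 : 'I_n.+1) i) => [j|] ->.
  under eq_fun do rewrite cons_rowS.
  exact: (measurableT_comp (measurable_coord j) measurable_snd).
under eq_fun do rewrite cons_row0.
exact: measurable_fst.
Qed.

Let uncons_row n (x : 'rV[R]_(1 + n)) : measurableTypeR R * 'rV[R]_n :=
  (x ord0 (lshift n ord0), rsubmx x).

Let cons_rowK n : cancel (@cons_row n) (@uncons_row n).
Proof.
move=> [t x]; rewrite /cons_row /uncons_row row_mxKr row_mxEl mxE eqxx.
by rewrite mulr1n.
Qed.

Let measurable_uncons_row n :
  measurable_fun [set: 'rV[R]_n.+1] (@uncons_row n).
Proof.
apply: measurable_fun_pair; first exact: measurable_coord.
apply/measurable_fun_rowP => i; under eq_fun do rewrite mxE.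
exact: measurable_coord.
Qed.

Section step.
Variables (n : nat) (mu : {sigma_finite_measure set 'rV[R]_n -> \bar R}).

Definition lebesgue_row_step : set 'rV[R]_n.+1 -> \bar R :=
  pushforward (lebesgue_measure \x mu) (@cons_row n).

Let step0 : lebesgue_row_step set0 = 0.
Proof. by rewrite /lebesgue_row_step /pushforward preimage_set0 measure0. Qed.

Let step_ge0 A : 0 <= lebesgue_row_step A.
Proof. by rewrite /lebesgue_row_step /pushforward; exact: measure_ge0. Qed.

Let step_sigma_additive : semi_sigma_additive lebesgue_row_step.
Proof.
exact: (@measure_semi_sigma_additive _ _ _
  (measure_function_pushforward__canonical__measure_function_Measure
    (lebesgue_measure \x mu) (@measurable_cons_row n))).
Qed.

HB.instance Definition _ := isMeasure.Build _ _ _ lebesgue_row_step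
  step0 step_ge0 step_sigma_additive.

Let step_sigma_finite : sigma_finite setT lebesgue_row_step.
Proof.
have /sigma_finiteP[F [FT ndF Foo]] := sigma_finiteT (@lebesgue_measure R).
have /sigma_finiteP[G [GT ndG Goo]] := sigma_finiteT mu.
exists (fun k => @uncons_row n @^-1` (F k `*` G k)).
  rewrite -preimage_bigcup (_ : \bigcup_k _ = setT) ?preimage_setT//.
  apply/seteqP; split => // -[t x] _.
  have [i _ Fit] : (\bigcup_i F i) t by rewrite -FT.
  have [j _ Gjx] : (\bigcup_j G j) x by rewrite -GT.
  exists (maxn i j) => //; split => /=.
    by move: t Fit; exact/subsetPset/ndF/leq_maxl.
  by move: x Gjx; exact/subsetPset/ndG/leq_maxr.
move=> k; have [mF Fk] := Foo k; have [mG Gk] := Goo k; split.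
  rewrite -[X in measurable X]setTI.
  by apply: measurable_uncons_row => //; exact: measurableX.
rewrite /lebesgue_row_step /pushforward -comp_preimage.
rewrite (_ : _ \o _ = id) ?preimage_id; last exact/funext/cons_rowK.
by rewrite product_measure1E// lte_mul_pinfty// ge0_fin_numE.
Qed.

HB.instance Definition _ := Measure_isSigmaFinite.Build _ _ _
  lebesgue_row_step step_sigma_finite.

End step.

Fixpoint lebesgue_row_rec n : {sigma_finite_measure set 'rV[R]_n -> \bar R} :=
  if n is m.+1 then lebesgue_row_step (lebesgue_row_rec m) else \d_(0%R : 'rV[R]_0).

(* Lebesgue measure on R^n, the n-fold product of the one on R. *)
Definition lebesgue_row n : set 'rV[R]_n -> \bar R := lebesgue_row_rec n.

HB.instance Definition _ n := SigmaFiniteMeasure.on (@lebesgue_row n).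

Lemma lebesgue_row_box n (A : 'I_n -> set (measurableTypeR R)) :
  (forall i, measurable (A i)) ->
  lebesgue_row [set x : 'rV[R]_n | forall i, A i (x ord0 i)] =
  \prod_(i < n) lebesgue_measure (A i).
Proof.
rewrite /lebesgue_row; elim: n A => [|n IH] A mA.
  by rewrite big_ord0 /= diracE mem_set// => -[].
have -> : lebesgue_row_rec n.+1 [set x : 'rV_n.+1 | forall i, A i (x ord0 i)] =
    (lebesgue_measure \x lebesgue_row_rec n)
      (A ord0 `*` [set x : 'rV[R]_n | forall i, A (lift ord0 i) (x ord0 i)]).
  rewrite /= /lebesgue_row_step /pushforward; congr (_ _).
  apply/seteqP; split => -[t x] /=.
    move=> H; split; first by have := H ord0; rewrite cons_row0.
    by move=> i; have := H (lift ord0 i); rewrite cons_rowS.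
  move=> [At Ax] i; case: (unliftP ord0 i) => [j|] ->.
    by rewrite cons_rowS.
  by rewrite cons_row0.
rewrite product_measure1E//.
  rewrite big_ord_recl; congr (_ * _).
  by rewrite -(IH (fun i => A (lift ord0 i))).
suff -> : [set x : 'rV[R]_n | forall i, A (lift ord0 i) (x ord0 i)] =
    \bigcap_(i in [set: 'I_n])
      (fun x : 'rV[R]_n => x ord0 i) @^-1` A (lift ord0 i).
  apply: fin_bigcap_measurable => // i _.
  rewrite -[X in measurable X]setTI.
  exact: (measurable_coord i measurableT (mA (lift ord0 i))).
by apply/seteqP; split => x /= H i; [move=> _|]; exact: H.
Qed.

End lebesgue_measure_row.

Section regular_variation.
Context {R : realType}.

Definition regularly_varying (rho : R) (V : R -> R) : Prop :=
  exists A : R, [/\ 0 < A,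
    measurable_fun `[A, +oo[ V,
    forall t, A <= t -> 0 < V t &
    forall x, 0 < x -> V (t * x) / V t @[t --> +oo%R] --> x `^ rho].

End regular_variation.

(* Elements of L^p_loc are represented by everywhere defined Borel functions;
   this loses nothing, since every Lebesgue measurable function agrees almost
   everywhere with a Borel one. *)
Section local_integrability.
Context {R : realType} {n : nat}.
Implicit Types (f : 'rV[R]_n -> R) (g : R * 'rV[R]_n -> R).

Definition spacetime_measure : set (measurableTypeR R * 'rV[R]_n) -> \bar R :=
  (lebesgue_measure \x @lebesgue_row R n)%E.

HB.instance Definition _ := Measure.on spacetime_measure.

Definition locally_L1 f : Prop :=
  measurable_fun [set: 'rV[R]_n] f /\
  forall K : set 'rV[R]_n, compact K ->
    (\int[@lebesgue_row R n]_(x in K) `|f x|%:E < +oo)%E.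

Definition locally_Lp_halfspace (p : R) g : Prop :=
  let D : set (R * 'rV[R]_n) := `[0, +oo[ `*` setT in
  measurable_fun (D : set (measurableTypeR R * 'rV[R]_n)) g /\
  forall K : set (R * 'rV[R]_n), K `<=` D -> compact K ->
    (\int[spacetime_measure]_(z in K) (`|g z| `^ p)%:E < +oo)%E.

End local_integrability.

Section test_functions.
Context {R : realType} {n : nat}.
Implicit Types (A : set R) (f : R -> R) (phi : R * 'rV[R]_n -> R).

(* Derivative along A: one-sided at the end points when A is an interval. *)
Definition derivable_within A f t : Prop :=
  cvg ((f s - f t) / (s - t) @[s --> within A t^']).

Definition derive_within A f t : R :=
  lim ((f s - f t) / (s - t) @[s --> within A t^']).

Definition time_derivative (T : R) phi : R * 'rV[R]_n -> R :=
  fun z => derive_within `[0, T] (fun s => phi (s, z.2)) z.1.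

Definition basis_vector (j : 'I_n) : 'rV[R]_n := delta_mx 0 j.

Definition space_derivable (j : 'I_n) phi (z : R * 'rV[R]_n) : Prop :=
  derivable (fun y => phi (z.1, y)) z.2 (basis_vector j).

Definition space_derivative (j : 'I_n) phi : R * 'rV[R]_n -> R :=
  fun z => 'D_(basis_vector j) (fun y => phi (z.1, y)) z.2.

Definition laplacian phi : R * 'rV[R]_n -> R :=
  fun z => \sum_(j < n) space_derivative j (space_derivative j phi) z.

Definition slab (T : R) : set (R * 'rV[R]_n) := `[0, T] `*` setT.

Definition C12 (T : R) phi : Prop :=
  [/\ {within slab T, continuous phi},
      (forall z, slab T z ->
         derivable_within `[0, T] (fun s => phi (s, z.2)) z.1) /\
      {within slab T, continuous (time_derivative T phi)},
      forall j, (forall z, slab T z -> space_derivable j phi z) /\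
                {within slab T, continuous (space_derivative j phi)} &
      forall j k, (forall z, slab T z ->
                     space_derivable k (space_derivative j phi) z) /\
        {within slab T, continuous
           (space_derivative k (space_derivative j phi))}].

Definition compactly_supported_in_space (T : R) phi : Prop :=
  exists2 K : set 'rV[R]_n, compact K &
    forall t x, 0 <= t <= T -> ~ K x -> phi (t, x) = 0.

Definition test_function (T : R) phi : Prop :=
  [/\ C12 T phi,
      forall z, slab T z -> 0 <= phi z,
      compactly_supported_in_space T phi &
      forall x, phi (T, x) = 0].

End test_functions.

Section weak_solution.
Context {R : realType} {n : nat}.
Implicit Types (p : R) (w : 'rV[R]_n -> R) (u : R * 'rV[R]_n -> R).

Definition weak_formulation p w (u0 : 'rV[R]_n -> R) u (T : R)
    (phi : R * 'rV[R]_n -> R) : Prop :=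
  \int[spacetime_measure]_(z in slab T) ((`|u z| `^ p + w z.2) * phi z)
    + \int[@lebesgue_row R n]_x (u0 x * phi (0, x))
  = - (\int[spacetime_measure]_(z in slab T) (u z * time_derivative T phi z))
    - \int[spacetime_measure]_(z in slab T) (u z * laplacian phi z).

Definition global_weak_solution p w (u0 : 'rV[R]_n -> R) u : Prop :=
  [/\ locally_Lp_halfspace p u,
      {ae spacetime_measure, forall z, 0 <= z.1 -> 0 <= u z} &
      forall T, 0 < T -> forall phi, test_function T phi ->
        weak_formulation p w u0 u T phi].

Definition no_global_weak_solution p w : Prop :=
  forall u0 : 'rV[R]_n -> R,
    locally_L1 u0 -> {ae @lebesgue_row R n, forall x, 0 <= u0 x} ->
    ~ exists u, global_weak_solution p w u0 u.

End weak_solution.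

Section operator_mass.
Context {R : realType}.

(* The operator E is the diagonal matrix [diag_mx alpha]. *)
Definition operator_box n (alpha : 'rV[R]_n) (r : R) : set 'rV[R]_n :=
  [set x | forall j, `|x 0 j| <= r `^ (alpha 0 j)].

Definition operator_mass n (alpha : 'rV[R]_n) (w : 'rV[R]_n -> R) (r : R) : R :=
  \int[@lebesgue_row R n]_(x in operator_box alpha r) w x.

Definition lambda_min N (alpha : 'rV[R]_N.+1) : R :=
  \big[Num.min/alpha 0 0]_(j < N.+1) alpha 0 j.

Definition critical_exponent (q lmin : R) : \bar R :=
  if 2 * lmin < q then (q / (q - 2 * lmin))%:E else +oo%E.

End operator_mass.

(* Main.v *)
Require Import Defs.
From HB Require Import structures.
From mathcomp Require Import all_boot all_order all_algebra.
From mathcomp Require Import all_classical all_reals all_analysis.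
From mathcomp Require Import measurable_realfun ring lra zify.

Import Order.TTheory GRing.Theory Num.Theory.
Import numFieldNormedType.Exports.

Local Open Scope classical_set_scope.
Local Open Scope ring_scope.

(** The proof is the test function method of Mitidieri and Pohozaev, run on the
    boxes [operator_box alpha r] that define the mass. Write [lam] for
    [lambda_min alpha], |E| for the trace of E, [p' = p / (p - 1)], and [F r]
    for the operator mass.

    Test the equation with a cutoff [phi] which is the [k.+3]-rd power of a
    function [b] with values in [0, 1], adapted to the time scale [T] and to
    the half-widths [a j]. Two derivatives cost two powers of [b], so that
    [|phi_t + Lap phi| <= K * b ^+ k.+1] with [K] of order
    [T^-1 + \sum_j (a j) ^- 2] ([time_derivative_cutoff_le],
    [laplacian_cutoff_le]). If [k] is so large that [(k + 1) p >= k + 3], then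
    [(b ^+ k.+1) `^ p <= phi], and an elementary form of Young's inequality
    ([young_absorption]) bounds [- u * (phi_t + Lap phi)] by
    [|u| `^ p * phi + K `^ p'] at each point. The term [|u| `^ p * phi] cancels
    against the same term of the equation, the initial datum contributes with
    a favourable sign, and what remains is ([mass_upper_bound])
      the integral of [w * phi] is at most [K `^ p'] times the volume of the
      support of [phi].

    Now take [a j = 2 * r `^ alpha_j] and [T = r `^ (2 * lam)]. For [r >= 1]
    every [(a j) ^- 2] is at most [r `^ (- 2 lam)], hence so is [K] up to a
    constant; the support has volume of order [T * r `^ |E|]; and [phi] is
    bounded below on half of the time interval times [operator_box alpha r],
    so the left-hand side is at least a constant times [T * F r]
    ([mass_lower_bound]). The factors [T] cancel and ([operator_mass_le])
      [F r <= C * r `^ (|E| - 2 lam p')] for all [r >= 1].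

    Subcritical [p] means exactly that the exponent on the right is smaller
    than [gammaE]. This is impossible for a regularly varying [F] of index
    [gammaE]: for each [s < gammaE] eventually [F (2 t) >= 2 `^ s * F t], so
    along [2 ^+ n * t0] the function grows at least like the power [s]
    ([regularly_varying_not_dominated]). At the critical exponent the two
    powers agree, and the estimate says that [L] is bounded. *)

Set Implicit Arguments.
Unset Strict Implicit.

(** * Products of functions of one variable *)

Section tensor.
Context {R : realType} {n : nat}.
Implicit Types (eta : R -> R) (f : 'I_n -> R -> R).

Definition tensor eta f (z : R * 'rV[R]_n) : R :=
  eta z.1 * \prod_(i < n) f i (z.2 0 i).

Definition replace_factor f (j : 'I_n) (g : R -> R) (i : 'I_n) : R -> R :=
  if i == j then g else f i.

Lemma tensor_replace_factor eta f j g z :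
  tensor eta (replace_factor f j g) z =
  eta z.1 * \prod_(i < n | i != j) f i (z.2 0 i) * g (z.2 0 j).
Proof.
rewrite /tensor (bigD1 j)//= {1}/replace_factor eqxx [g _ * _]mulrC mulrA.
by congr (_ * _ * _); apply: eq_bigr => i /negPf ij; rewrite /replace_factor ij.
Qed.

(** Along [basis_vector j] only the [j]-th factor varies, so the difference
    quotient of the product is that of a multiple of [f j]. *)
Lemma space_growth_tensor eta f j (z : R * 'rV[R]_n) :
  let c := eta z.1 * \prod_(i < n | i != j) f i (z.2 0 i) in
  (fun h : R => h^-1 *: (tensor eta f (z.1, h *: basis_vector j + z.2)
     - tensor eta f (z.1, z.2))) =
  (fun h : R => h^-1 *: ((c \*: f j) (h *: (1 : R) + z.2 0 j)
     - (c \*: f j) (z.2 0 j))).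
Proof.
move=> c; apply/funext => h; congr (_ *: _).
rewrite /tensor /= !(bigD1 (P := xpredT) j)//=; congr (_ - _); last first.
  by rewrite /c /GRing.scale/=; ring.
rewrite (_ : \prod_(i < n | i != j) _ = \prod_(i < n | i != j) f i (z.2 0 i)).
  by rewrite !mxE !eqxx /c /GRing.scale/=; ring.
by apply: eq_bigr => i /negPf ij; rewrite !mxE eqxx ij mulr0 add0r.
Qed.

Lemma space_derivable_tensor eta f j (g : R -> R) :
  (forall s : R, is_derive s 1 (f j) (g s)) ->
  forall z, space_derivable j (tensor eta f) z.
Proof.
move=> fg z; rewrite /space_derivable /derivable space_growth_tensor.
by have [] := fg (z.2 0 j) => df _; exact: derivableZ.
Qed.

Lemma space_derivative_tensor eta f j (g : R -> R) :
  (forall s : R, is_derive s 1 (f j) (g s)) ->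
  space_derivative j (tensor eta f) = tensor eta (replace_factor f j g).
Proof.
move=> fg; apply/funext => z; rewrite tensor_replace_factor.
rewrite /space_derivative /derive space_growth_tensor.
set c := _ * _; have := @is_deriveZ _ _ _ (f j) c (z.2 0 j) 1 _ (fg (z.2 0 j)).
by case=> _; apply.
Qed.

Lemma continuous_tensor eta f : continuous eta ->
  (forall i, continuous (f i)) -> continuous (tensor eta f).
Proof.
move=> ceta cf z; apply: cvgM.
  by apply: continuous_comp; [exact: cvg_fst|exact: ceta].
apply: (@continuous_big _ _ _ _ xpredT _ _ _
  (fun i (z : R * 'rV[R]_n) => f i (z.2 0 i))).
  by move=> x; apply: cvgM; [exact: cvg_fst|exact: cvg_snd].
move=> i _ y; apply: (continuous_comp (g := f i)); last exact: cf.
apply: (continuous_comp (g := fun x : 'rV[R]_n => x 0 i)).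
  exact: cvg_snd.
exact: coord_continuous.
Qed.

Lemma measurable_tensor eta f : measurable_fun setT eta ->
  (forall i, measurable_fun setT (f i)) ->
  measurable_fun [set: measurableTypeR R * 'rV[R]_n] (tensor eta f).
Proof.
move=> meta mf; apply: measurable_funM.
  by apply: measurableT_comp => //; exact: measurable_fst.
apply: (@measurable_prod _ _ _ _ _ _
  (fun i (z : measurableTypeR R * 'rV[R]_n) => f i (z.2 0 i))) => i _.
apply: measurableT_comp => //.
exact: (measurableT_comp (measurable_coord i) measurable_snd).
Qed.

End tensor.

(** * Derivatives within a compact time interval *)

Section time.
Context {R : realType}.

(** Every point of a nondegenerate interval is a limit of other points of it;
    this makes the limit defining [derive_within] unique. *)
Lemma within_itv_dnbhs_proper (T t : R) : 0 < T -> 0 <= t <= T ->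
  ProperFilter (within `[0, T] (t^')).
Proof.
move=> T0 /andP[t0 tT].
apply: Build_ProperFilter_ex => P.
rewrite /within/= /dnbhs /within/= => /nbhs_ballP[e /= e0 eP].
have [tT2|tT2] := ltP t T.
  pose d := Num.min (e / 2) (T - t).
  have d0 : 0 < d by rewrite lt_min divr_gt0// subr_gt0.
  have de : d < e by rewrite gt_min ltr_pdivrMr// ltr_pMr// ltr1n.
  exists (t + d); apply: eP => /=.
  - by rewrite /ball/= opprD addrA subrr add0r normrN gtr0_norm.
  - by rewrite gt_eqF// ltrDl.
  - rewrite in_itv/=; apply/andP; split; first lra.
    by rewrite -lerBrDl ge_min lexx orbT.
have tE : t = T by apply/le_anti; rewrite tT.
pose d := Num.min (e / 2) T.
have d0 : 0 < d by rewrite lt_min divr_gt0.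
have de : d < e by rewrite gt_min ltr_pdivrMr// ltr_pMr// ltr1n.
have dT : d <= T by rewrite ge_min lexx orbT.
exists (t - d); apply: eP => /=.
- by rewrite /ball/= opprB addrC subrK gtr0_norm.
- by rewrite lt_eqF// ltrBlDr ltrDl.
- by rewrite in_itv/=; apply/andP; split; lra.
Qed.

Lemma is_derive_within (T t : R) (f : R -> R) df :
  0 < T -> 0 <= t <= T -> is_derive t 1 f df ->
  derivable_within `[0, T] f t /\ derive_within `[0, T] f t = df.
Proof.
move=> T0 tT [fd fE].
have PF := within_itv_dnbhs_proper T0 tT.
have H : (f s - f t) / (s - t) @[s --> within `[0, T] t^'] --> df.
  apply: cvg_within_filter.
  have F : h^-1 *: (f (h *: (1 : R) + t) - f t) @[h --> 0^'] --> df.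
    by rewrite -fE; exact: fd.
  apply/cvgrPdist_le => e e0.
  move/cvgrPdist_le : F => /(_ _ e0).
  rewrite !near_withinE => /nbhs_ballP[d /= d0 dP].
  apply/nbhs_ballP; exists d => //= s ts st.
  have := dP (s - t); rewrite /ball/= sub0r normrN distrC => /(_ ts).
  rewrite subr_eq0 => /(_ st).
  by rewrite /GRing.scale/= mulr1 subrK mulrC.
split; first by apply/cvg_ex; exists df.
exact/cvg_lim.
Qed.

End time.

(** * Regularity of products *)

Section test_function_tensor.
Context {R : realType} {n : nat}.
Variables (T : R) (T0 : 0 < T).
Variables (eta eta' : R -> R) (f f' f'' : 'I_n -> R -> R).
Hypothesis eta_derive : forall t : R, is_derive t 1 eta (eta' t).
Hypothesis f_derive : forall i (s : R), is_derive s 1 (f i) (f' i s).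
Hypothesis f'_derive : forall i (s : R), is_derive s 1 (f' i) (f'' i s).
Hypothesis eta'_cont : continuous eta'.
Hypothesis f''_cont : forall i, continuous (f'' i).

Let is_derive_continuous (g g' : R -> R) :
  (forall s : R, is_derive s 1 g (g' s)) -> continuous g.
Proof.
move=> gg s; apply: differentiable_continuous; apply/derivable1_diffP.
by case: (gg s).
Qed.

Lemma time_derivative_tensor z : slab T z ->
  derivable_within `[0, T] (fun s => tensor eta f (s, z.2)) z.1 /\
  time_derivative T (tensor eta f) z = tensor eta' f z.
Proof.
move=> [/= +  _]; rewrite in_itv/= => zT; rewrite /time_derivative /tensor/=.
apply: is_derive_within => //.
set c := \prod_(i < n) _.
rewrite (_ : (fun s => _) = c \*: eta); last first.
  by apply/funext => s; rewrite /GRing.scale/= mulrC.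
by rewrite mulrC; exact: is_deriveZ.
Qed.

Lemma laplacian_tensor : laplacian (tensor eta f) =
  fun z => \sum_(j < n) tensor eta (replace_factor f j (f'' j)) z.
Proof.
apply/funext => z; apply: eq_bigr => j _.
rewrite (space_derivative_tensor _ (f_derive j)).
have dg (s : R) : is_derive s 1 (replace_factor f j (f' j) j) (f'' j s).
  by rewrite /replace_factor eqxx.
rewrite (space_derivative_tensor _ dg) !tensor_replace_factor.
congr (_ * _ * _); apply: eq_bigr => i /negPf ij.
by rewrite /replace_factor ij.
Qed.

Lemma C12_tensor : C12 T (tensor eta f).
Proof.
have ceta := is_derive_continuous eta_derive.
have cf i := is_derive_continuous (f_derive i).
have cf' i := is_derive_continuous (f'_derive i).
split.
- exact/continuous_subspaceT/continuous_tensor.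
- split; first by move=> z /time_derivative_tensor[].
  apply: (@subspace_eq_continuous _ _ _ (tensor eta' f)).
    by move=> z /set_mem /time_derivative_tensor[].
  exact/continuous_subspaceT/continuous_tensor.
- move=> j; split; first by move=> z _; exact: space_derivable_tensor.
  rewrite (space_derivative_tensor _ (f_derive j)).
  apply/continuous_subspaceT/continuous_tensor => // i.
  by rewrite /replace_factor; case: eqP.
move=> j k; rewrite (space_derivative_tensor _ (f_derive j)).
pose g := if k == j then f'' j else f' k.
have dg (s : R) : is_derive s 1 (replace_factor f j (f' j) k) (g s).
  by rewrite /g /replace_factor; case: eqP.
split; first by move=> z _; exact: space_derivable_tensor.
rewrite (space_derivative_tensor _ dg).
apply/continuous_subspaceT/continuous_tensor => // i.
rewrite /replace_factor /g.
by case: eqP => _; case: eqP.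
Qed.

End test_function_tensor.

(** * The one-dimensional profile *)

Section hat.
Context {R : realType}.
Implicit Types (a s x : R) (m k : nat).

Let pos_part_l x : x <= 0 -> Num.max 0 x = 0.
Proof. by move=> x0; rewrite max_l. Qed.

Let pos_part_r x : 0 <= x -> Num.max 0 x = x.
Proof. by move=> x0; rewrite max_r. Qed.

Let pos_part_ge0 x : 0 <= Num.max 0 x.
Proof. by rewrite le_max lexx. Qed.

Lemma continuous_pos_part_pow m : continuous (fun y : R => Num.max 0 y ^+ m).
Proof.
move=> x; apply: (continuous_comp (g := fun y : R => y ^+ m)).
  by apply: (@continuous_max _ _ (cst 0) id); [exact: cvg_cst|exact: cvg_id].
exact: exprn_continuous.
Qed.

Lemma is_derive_pos_part_pow m x :
  is_derive x 1 (fun y : R => Num.max 0 y ^+ m.+2)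
    (m.+2%:R * Num.max 0 x ^+ m.+1).
Proof.
have [x0|x0|->] := ltgtP x 0.
- apply: (@near_eq_is_derive _ _ _ (cst 0)).
    apply: filterS (lt_nbhsl x0) => y y0.
    by rewrite (pos_part_l (ltW y0)) expr0n.
  by rewrite expr0n mulr0; exact: is_derive_cst.
- have D := @is_deriveX _ _ id m.+2 x 1 1 (is_derive_id x 1).
  rewrite /GRing.scale/= mulr1 in D; apply: near_eq_is_derive D.
  apply: filterS (lt_nbhsr x0) => y y0.
  by rewrite (pos_part_r (ltW y0)) fctE.
(* At 0 the difference quotient is again a power of the positive part. *)
have H : h^-1 *: (Num.max 0 (h *: (1 : R) + 0) ^+ m.+2 - Num.max 0 0 ^+ m.+2)
    @[h --> 0^'] --> (0 : R).
  apply: (@cvg_trans _ (Num.max 0 h ^+ m.+1 @[h --> (0 : R)^'])).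
    apply: near_eq_cvg; near=> h.
    have h0 : h != 0 by near: h; exact: nbhs_dnbhs_neq.
    rewrite maxxx expr0n subr0 /GRing.scale/= mulr1 addr0.
    have [h1|h1] := leP h 0; first by rewrite !expr0n mulr0.
    by rewrite [in RHS]exprS mulrA mulVf// mul1r.
  apply: cvg_within_filter.
  have := @continuous_pos_part_pow m.+1 0.
  by rewrite /continuous_at maxxx expr0n.
rewrite expr0n mulr0.
apply: DeriveDef; first by apply/cvg_ex; exists 0.
exact/cvg_lim.
Unshelve. all: by end_near. Qed.

(** A profile of class C^2 as soon as [3 <= m], with support [-1, 1], whose
    derivatives are controlled by lower powers of the same function. *)
Definition hat m s : R := Num.max 0 (1 - s ^+ 2) ^+ m.

Lemma hat_ge0 m s : 0 <= hat m s.
Proof. exact/exprn_ge0/pos_part_ge0. Qed.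

Lemma hat_le1 m s : hat m s <= 1.
Proof.
by rewrite exprn_ile1// ?pos_part_ge0// ge_max ler01 gerBl sqr_ge0.
Qed.

Lemma hat_le m1 m2 s : (m1 <= m2)%N -> hat m2 s <= hat m1 s.
Proof.
by move=> m12; rewrite ler_wiXn2l// ?pos_part_ge0// ge_max ler01 gerBl sqr_ge0.
Qed.

Lemma hat_out m s : 1 <= `|s| -> hat m.+1 s = 0.
Proof.
move=> s1; rewrite /hat pos_part_l ?expr0n//.
by rewrite subr_le0 -real_normK ?num_real// exprn_ege1.
Qed.

Lemma hat_half m s : `|s| <= 2^-1 -> (3 / 4) ^+ m <= hat m s.
Proof.
move=> s2; apply: lerXn2r; rewrite ?nnegrE ?pos_part_ge0 ?divr_ge0//.
rewrite le_max; apply/orP; right; rewrite -[s ^+ 2]real_normK ?num_real//.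
have : `|s| ^+ 2 <= 2^-1 ^+ 2 by rewrite ler_sqr ?nnegrE//.
lra.
Qed.

Lemma continuous_hat m : continuous (hat m).
Proof.
move=> s; apply: (continuous_comp (f := fun y : R => 1 - y ^+ 2)
  (g := fun y => Num.max 0 y ^+ m)); last exact: continuous_pos_part_pow.
by apply: cvgB; [exact: cvg_cst|exact: exprn_continuous].
Qed.

Lemma is_derive_hat_scaled m a s :
  is_derive s 1 (fun y => hat m.+2 (y / a))
    (- (2 * m.+2%:R / a ^+ 2) * (s * hat m.+1 (s / a))).
Proof.
have D : is_derive s 1 (fun y => 1 - (y / a) ^+ 2) (- (2 * s / a ^+ 2)).
  rewrite (_ : (fun y => _) = cst 1 - (a ^- 2 \*: (@id R) ^+ 2)); last first.
    by apply/funext => y; rewrite !fctE /= /GRing.scale/= expr_div_n mulrC.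
  apply: is_derive_eq; rewrite /GRing.scale/=; ring.
have := @is_derive1_comp _ (fun y => Num.max 0 y ^+ m.+2)
  (fun y => 1 - (y / a) ^+ 2) s _ _
  (is_derive_pos_part_pow m (1 - (s / a) ^+ 2)) D.
move=> H; apply: (is_derive_eq H); rewrite /hat; ring.
Qed.

(** The second derivative of [fun s => hat k.+3 (s / a)]. *)
Definition hat_scaled'' k a s :=
  - (2 * k.+3%:R / a ^+ 2) * (hat k.+2 (s / a) +
     - (2 * k.+2%:R / a ^+ 2) * (s ^+ 2 * hat k.+1 (s / a))).

Lemma is_derive2_hat_scaled k a s :
  is_derive s 1 (fun y => - (2 * k.+3%:R / a ^+ 2) * (y * hat k.+2 (y / a)))
    (hat_scaled'' k a s).
Proof.
have D := is_derive_hat_scaled k a s.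
rewrite (_ : (fun y => _) =
    (- (2 * k.+3%:R / a ^+ 2)) \*: ((@id R) * (fun y => hat k.+2 (y / a)))).
  by apply: is_derive_eq; rewrite /hat_scaled'' /GRing.scale/=; ring.
by apply/funext => y.
Qed.

(** The factor [s] in [hat_scaled''] is harmless because [|s| <= a] on the
    support; two derivatives cost a factor [a ^- 2] and two powers. *)
Lemma hat_scaled''_le k a s : 0 < a ->
  `|hat_scaled'' k a s| <=
    (2 * k.+3%:R * (2 * k.+2%:R + 1)) / a ^+ 2 * hat k.+1 (s / a).
Proof.
move=> a0; have [s1|s1] := leP 1 `|s / a|.
  by rewrite /hat_scaled'' !hat_out// !mulr0 addr0 mulr0 normr0.
have r1 : (s / a) ^+ 2 <= 1.
  by rewrite -real_normK ?num_real// exprn_ile1// ltW.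
have r0 : 0 <= (s / a) ^+ 2 by exact: sqr_ge0.
have b12 := @hat_le k.+1 k.+2 (s / a) (leqnSn _).
have b20 := hat_ge0 k.+2 (s / a).
rewrite (_ : hat_scaled'' k a s = - (2 * k.+3%:R / a ^+ 2) *
    (hat k.+2 (s / a) - 2 * k.+2%:R * ((s / a) ^+ 2 * hat k.+1 (s / a)))).
  move: r0 r1 b12 b20; set r := (s / a) ^+ 2; set b1 := hat _ _.
  set b2 := hat _ _ => r0 r1 b12 b20.
  have b0 := le_trans b20 b12.
  have rb0 : 0 <= r * b2 by rewrite mulr_ge0.
  have rb1 : r * b2 <= b2 by rewrite ler_piMl.
  have H : `|b1 - 2 * k.+2%:R * (r * b2)| <= (2 * k.+2%:R + 1) * b2.
    have d0 : 0 <= 2 * k.+2%:R :> R by rewrite mulr_ge0.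
    have H0 := mulr_ge0 d0 rb0.
    have H1 : 2 * k.+2%:R * (r * b2) <= 2 * k.+2%:R * b2 by exact: ler_wpM2l.
    rewrite ler_norml mulrDl mul1r.
    by apply/andP; split; clear -H0 H1 b20 b12; clearbody b1 b2; lra.
  have c0 : 0 <= 2 * k.+3%:R / a ^+ 2 :> R.
    by apply: divr_ge0; [exact: mulr_ge0|exact: sqr_ge0].
  rewrite normrM normrN (ger0_norm c0).
  rewrite [leRHS](_ : _ =
    2 * k.+3%:R / a ^+ 2 * ((2 * k.+2%:R + 1) * b2)); last by ring.
  exact: ler_wpM2l.
rewrite /hat_scaled'' expr_div_n; congr (_ * (_ + _)); ring.
Qed.

Lemma continuous_hat_scaled m a : continuous (fun s => hat m (s / a)).
Proof.
move=> s; apply: (continuous_comp (f := fun y : R => y / a) (g := hat m)).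
  by apply: cvgM; [exact: cvg_id|exact: cvg_cst].
exact: continuous_hat.
Qed.

Lemma continuous_hat_scaled'' k a : continuous (hat_scaled'' k a).
Proof.
move=> s; apply: cvgM; first exact: cvg_cst.
apply: cvgD; first exact: continuous_hat_scaled.
apply: cvgM; first exact: cvg_cst.
by apply: cvgM; [exact: exprn_continuous|exact: continuous_hat_scaled].
Qed.

End hat.

(** * The space-time cutoff *)

Section cutoff.
Context {R : realType} {n : nat}.
Variables (T : R) (a : 'I_n -> R).
Hypotheses (T_gt0 : 0 < T) (a_gt0 : forall i, 0 < a i).
Implicit Types (m k : nat) (t : R) (x : 'rV[R]_n) (z : R * 'rV[R]_n).

(** In time a polynomial is enough: test functions are only required to be
    regular on [0, T] and to vanish at [T], so no truncation is needed there. *)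
Definition cutoff m : R * 'rV[R]_n -> R :=
  tensor (fun t => (1 - t / T) ^+ m) (fun i s => hat m (s / a i)).

Definition box : set 'rV[R]_n := [set x | forall i, `|x 0 i| <= a i].

(** The cutoffs of different orders are powers of one function; this is what
    makes [cutoff k.+1 z `^ p] comparable with [cutoff k.+3 z]. *)
Lemma cutoffX m z : cutoff m z = cutoff 1 z ^+ m.
Proof.
rewrite /cutoff /tensor expr1 exprMn -prodrXl; by congr (_ * _).
Qed.

Let time_itv t : 0 <= t <= T -> 0 <= 1 - t / T <= 1.
Proof.
move=> /andP[t0 tT]; rewrite subr_ge0 ler_pdivrMr// mul1r tT/=.
by rewrite gerBl divr_ge0// ltW.
Qed.

Lemma cutoff_itv m z : 0 <= z.1 <= T -> 0 <= cutoff m z <= 1.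
Proof.
move=> /time_itv /andP[h0 h1]; apply/andP; split.
  apply: mulr_ge0; first exact: exprn_ge0.
  by apply: prodr_ge0 => i _; exact: hat_ge0.
apply: mulr_ile1; first exact: exprn_ge0.
- by apply: prodr_ge0 => i _; exact: hat_ge0.
- exact: exprn_ile1.
- by apply: prodr_ile1 => i _; rewrite hat_ge0 hat_le1.
Qed.

Lemma cutoff_out m z : ~ box z.2 -> cutoff m.+1 z = 0.
Proof.
move=> /existsNP[i /negP]; rewrite -ltNge => ai.
rewrite /cutoff /tensor (bigD1 i)//= hat_out ?mul0r ?mulr0//.
by rewrite normrM normfV (gtr0_norm (a_gt0 i)) ler_pdivlMr// mul1r ltW.
Qed.

Lemma cutoff_ge m z : 0 <= z.1 <= T / 2 ->
  (forall i, `|z.2 0 i| <= a i / 2) ->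
  2^-1 ^+ m * \prod_(i < n) (3 / 4) ^+ m <= cutoff m z.
Proof.
move=> /andP[t0 tT] xa; apply: ler_pM.
- by rewrite exprn_ge0.
- by apply: prodr_ge0 => i _; rewrite exprn_ge0// divr_ge0.
- apply: lerXn2r; rewrite ?nnegrE ?invr_ge0//.
    have : z.1 / T <= 1 by rewrite ler_pdivrMr//; lra.
    lra.
  have : z.1 / T <= 2^-1 by rewrite ler_pdivrMr// mulrC.
  lra.
apply: ler_prod => i _; rewrite exprn_ge0 ?divr_ge0//=; apply: hat_half.
by rewrite normrM normfV (gtr0_norm (a_gt0 i)) ler_pdivrMr// mulrC.
Qed.

Let eta_cont m : continuous (fun t : R => (1 - t / T) ^+ m).
Proof.
move=> t; apply: (continuous_comp (f := fun t : R => 1 - t / T)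
  (g := fun y : R => y ^+ m)); last exact: exprn_continuous.
apply: cvgB; first exact: cvg_cst.
by apply: cvgM; [exact: cvg_id|exact: cvg_cst].
Qed.

Lemma measurable_cutoff m :
  measurable_fun [set: measurableTypeR R * 'rV[R]_n] (cutoff m).
Proof.
apply: measurable_tensor => [|i]; apply: continuous_measurable_fun.
  exact: eta_cont.
exact: continuous_hat_scaled.
Qed.

Let eta' k t := k.+3%:R * (1 - t / T) ^+ k.+2 * - T^-1.

Let eta'_derive k t : is_derive t 1 (fun t => (1 - t / T) ^+ k.+3) (eta' k t).
Proof.
rewrite (_ : (fun t => _) = (cst 1 - (T^-1 \*: (@id R))) ^+ k.+3).
  apply: is_derive_eq; rewrite /eta' /GRing.scale !fctE /= /GRing.scale/=.
  by rewrite mulr1 sub0r [T^-1 * t]mulrC.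
by apply/funext => s; rewrite !fctE /GRing.scale/= mulrC.
Qed.

Let eta'_cont k : continuous (eta' k).
Proof.
move=> t; apply: cvgM; last exact: cvg_cst.
by apply: cvgM; [exact: cvg_cst|exact: eta_cont].
Qed.

Lemma C12_cutoff k : C12 T (cutoff k.+3).
Proof.
apply: (C12_tensor T_gt0 (eta'_derive k)
  (fun i s => is_derive_hat_scaled k.+1 (a i) s)
  (fun i s => is_derive2_hat_scaled k (a i) s)); first exact: eta'_cont.
by move=> i; exact: continuous_hat_scaled''.
Qed.

Lemma box_compact : compact box.
Proof.
rewrite (_ : box = [set x | forall i, `[- a i, a i]%classic (x ord0 i)]).
  apply: (@rV_compact R n (fun i => `[- a i, a i]%classic)) => i.
  exact: segment_compact.
apply/seteqP; split => x /= xa i; have := xa i.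
  by rewrite in_itv/= ler_norml.
by rewrite in_itv/= ler_norml.
Qed.

Lemma test_function_cutoff k : test_function T (cutoff k.+3).
Proof.
split; first exact: C12_cutoff.
- move=> z [/= + _]; rewrite in_itv/= => zT.
  by have /andP[] := cutoff_itv k.+3 zT.
- exists box; first exact: box_compact.
  by move=> t x _; exact: (@cutoff_out _ (t, x)).
- by move=> x; rewrite /cutoff /tensor /= divff ?gt_eqF// subrr expr0n mul0r.
Qed.

Lemma time_derivative_cutoff k z : slab T z ->
  time_derivative T (cutoff k.+3) z =
  tensor (eta' k) (fun i s => hat k.+3 (s / a i)) z.
Proof.
move=> zT.
by have [] := time_derivative_tensor T_gt0 (fun i s => hat k.+3 (s / a i))
  (eta'_derive k) zT.
Qed.

Lemma laplacian_cutoff k : laplacian (cutoff k.+3) =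
  fun z => \sum_(j < n) tensor (fun t => (1 - t / T) ^+ k.+3)
    (replace_factor (fun i s => hat k.+3 (s / a i)) j (hat_scaled'' k (a j))) z.
Proof.
exact: (@laplacian_tensor _ _ _ _ _ (fun i => hat_scaled'' k (a i))
  (fun i s => is_derive_hat_scaled k.+1 (a i) s)
  (fun i s => is_derive2_hat_scaled k (a i) s)).
Qed.

Lemma measurable_time_derivative_cutoff k :
  measurable_fun (slab T : set (measurableTypeR R * 'rV[R]_n))
    (time_derivative T (cutoff k.+3)).
Proof.
apply: (@eq_measurable_fun _ _ _ _ _
    (tensor (eta' k) (fun i s => hat k.+3 (s / a i)))).
  by move=> z /set_mem zT; rewrite time_derivative_cutoff.
apply: measurable_funTS.
apply: measurable_tensor => [|i]; apply: continuous_measurable_fun.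
  exact: eta'_cont.
exact: continuous_hat_scaled.
Qed.

Lemma measurable_laplacian_cutoff k :
  measurable_fun [set: measurableTypeR R * 'rV[R]_n] (laplacian (cutoff k.+3)).
Proof.
rewrite laplacian_cutoff; apply: measurable_sum => j.
apply: measurable_tensor => [|i]; apply: continuous_measurable_fun.
  exact: eta_cont.
rewrite /replace_factor; case: eqP => _.
  exact: continuous_hat_scaled''.
exact: continuous_hat_scaled.
Qed.

Lemma time_derivative_cutoff_le k z : slab T z ->
  `|time_derivative T (cutoff k.+3) z| <= k.+3%:R / T * cutoff k.+1 z.
Proof.
move=> zT; rewrite time_derivative_cutoff// /cutoff /tensor.
have /time_itv/andP[h0 h1] : 0 <= z.1 <= T by case: zT => /=; rewrite in_itv.
have b0 : 0 <= k.+3%:R / T by rewrite divr_ge0// ltW.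
have -> : eta' k z.1 = - (k.+3%:R / T * (1 - z.1 / T) ^+ k.+2).
  by rewrite /eta' mulrN mulrAC.
rewrite normrM normrN (ger0_norm (mulr_ge0 b0 (exprn_ge0 _ h0))).
rewrite -mulrA; apply: ler_wpM2l => //; apply: ler_pM => //.
- exact: exprn_ge0.
- by apply: ler_wiXn2l.
- rewrite normr_prod; apply: ler_prod => i _.
  rewrite normr_ge0 (ger0_norm (hat_ge0 _ _)) hat_le//; lia.
Qed.

(** The constant of [hat_scaled''_le]. *)
Definition laplacian_constant k : R := 2 * k.+3%:R * (2 * k.+2%:R + 1).

Lemma laplacian_cutoff_le k z : slab T z ->
  `|laplacian (cutoff k.+3) z| <=
  (\sum_(j < n) laplacian_constant k / a j ^+ 2) * cutoff k.+1 z.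
Proof.
move=> zT; rewrite laplacian_cutoff.
have /time_itv/andP[h0 h1] : 0 <= z.1 <= T by case: zT => /=; rewrite in_itv.
apply: (le_trans (ler_norm_sum _ _ _)); rewrite mulr_suml.
apply: ler_sum => j _; rewrite tensor_replace_factor /cutoff /tensor.
rewrite [in leRHS](bigD1 j)//=.
rewrite [leRHS](_ : _ = (1 - z.1 / T) ^+ k.+1 *
    \prod_(i < n | i != j) hat k.+1 (z.2 0 i / a i) *
    (laplacian_constant k / a j ^+ 2 * hat k.+1 (z.2 0 j / a j))); last by ring.
rewrite normrM; apply: ler_pM => //; last exact: hat_scaled''_le.
rewrite normrM (ger0_norm (exprn_ge0 _ h0)); apply: ler_pM => //.
- exact: exprn_ge0.
- by apply: ler_wiXn2l => //; lia.
rewrite normr_prod; apply: ler_prod => i _.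
rewrite normr_ge0 (ger0_norm (hat_ge0 _ _)) hat_le//; lia.
Qed.

End cutoff.

(** * Integration over products of a time set and a space set *)

Section spacetime.
Context {R : realType} {n : nat}.
Local Notation mu := (@lebesgue_row R n).

Lemma box_measurable (a : 'I_n -> R) : measurable (box a).
Proof.
rewrite (_ : box a = \bigcap_(i in [set: 'I_n])
    (fun x : 'rV[R]_n => x 0 i) @^-1` `[- a i, a i]).
  apply: fin_bigcap_measurable => // i _; rewrite -[X in measurable X]setTI.
  exact: (@measurable_coord _ R n i measurableT _ (measurable_itv _)).
apply/seteqP; split => x /= xa i.
  by move=> _ /=; rewrite in_itv/= -ler_norml.
by have := xa i I; rewrite /= in_itv/= -ler_norml.
Qed.

Lemma box_volume (a : 'I_n -> R) : (forall i, 0 < a i) ->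
  mu (box a) = (\prod_(i < n) (2 * a i))%:E.
Proof.
move=> a0.
rewrite (_ : box a =
    [set x : 'rV[R]_n | forall i, `[- a i, a i]%classic (x ord0 i)]).
  rewrite (lebesgue_row_box (fun i => measurable_itv _)) -prodEFin.
  apply: eq_bigr => i _; rewrite lebesgue_measure_itv/= lte_fin.
  by rewrite gtrN// -EFinD opprK mulr2n mulrDl mul1r.
apply/seteqP; split => x /= xa i; have := xa i.
  by rewrite in_itv/= ler_norml.
by rewrite in_itv/= ler_norml.
Qed.

Lemma integral_cylinder (A : set (measurableTypeR R)) (K : set 'rV[R]_n)
    (g : 'rV[R]_n -> R) :
  measurable A -> measurable K ->
  measurable_fun setT g -> (forall x, 0 <= g x) ->
  (\int[spacetime_measure]_(z in A `*` K) (g z.2)%:E =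
   lebesgue_measure A * \int[mu]_(x in K) (g x)%:E)%E.
Proof.
move=> mA mK mg g0.
rewrite integral_mkcond /spacetime_measure.
have G0 : (0 <= \int[mu]_(x in K) (g x)%:E)%E.
  by apply: integral_ge0 => x _; rewrite lee_fin.
have mAK : measurable (A `*` K) by exact: measurableX.
pose h (z : measurableTypeR R * 'rV[R]_n) := (g z.2)%:E.
have mh : measurable_fun setT h.
  by apply/measurable_EFinP; exact: measurableT_comp.
have section_integral (t : measurableTypeR R) :
    (\int[mu]_x (h \_ (A `*` K)) (t, x) =
    \int[mu]_(x in K) (g x)%:E * (\1_A t)%:E)%E.
  rewrite indicE; have [tA|tA] := boolP (t \in A).
    rewrite mule1 [RHS]integral_mkcond; apply: eq_integral => x _.
    by rewrite !patchE in_setX tA.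
  rewrite mule0; apply: integral0_eq => x _.
  by rewrite !patchE in_setX (negPf tA).
have mhAK : measurable_fun setT (h \_ (A `*` K)).
  by apply/(measurable_restrictT _ mAK); exact: measurable_funTS.
rewrite (fubini_tonelli1 _ mhAK); last first.
  by move=> z; rewrite patchE; case: ifP; rewrite ?lee_fin.
rewrite (eq_integral _ _ (fun t _ => section_integral t)) ge0_integralZl//.
  by rewrite integral_indic// setIT muleC.
by apply/measurable_EFinP; exact: measurable_indic.
Qed.

Lemma ae_spacetime (P : 'rV[R]_n -> Prop) : {ae mu, forall x, P x} ->
  {ae @spacetime_measure R n, forall z, P z.2}.
Proof.
case=> B [mB B0 PB]; exists (setT `*` B); split.
- exact: measurableX.
- rewrite /spacetime_measure product_measure1E//.
  by rewrite [X in (_ * X)%E]B0 mule0.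
- by move=> z /= Pz; split => //; exact: PB.
Qed.

End spacetime.

(** * Absorbing the linear term *)

Section young.
Context {R : realType}.

(** With [x = |u| * b] this is [C * x <= x `^ p + C `^ p'] for the conjugate
    exponent [p']: whichever of [x `^ (p - 1)] and [C] is the larger one
    dominates the product. *)
Lemma young_absorption (p C b f u y : R) :
  1 < p -> 0 < C -> 0 <= b -> b `^ p <= f ->
  `|y| <= C * b -> - (u * y) <= `|u| `^ p * f + C `^ (p / (p - 1)).
Proof.
move=> p1 C0 b0 bf yb.
have p10 : 0 < p - 1 by rewrite subr_gt0.
have p0 : 0 < p by rewrite (lt_trans _ p1).
have f0 : 0 <= f by apply: le_trans bf; exact: powR_ge0.
apply: (le_trans (ler_norm _)); rewrite normrN normrM.
have ub0 : 0 <= `|u| * b by exact: mulr_ge0.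
have uy : `|u| * `|y| <= C * (`|u| * b).
  by rewrite mulrCA; apply: ler_wpM2l.
apply: (le_trans uy).
have [small|large] := leP (`|u| * b) (C `^ (p - 1)^-1).
  apply: (@le_trans _ _ (C `^ (p / (p - 1)))); last first.
    by rewrite lerDr mulr_ge0// powR_ge0.
  have -> : p / (p - 1) = 1 + (p - 1)^-1 by field; rewrite gt_eqF.
  rewrite powRD; last by rewrite (gt_eqF C0) implybT.
  by rewrite (powRr1 (ltW C0)) ler_pM2l.
apply: (@le_trans _ _ (`|u| `^ p * f)); last by rewrite lerDl powR_ge0.
apply: (@le_trans _ _ ((`|u| * b) `^ p)); last first.
  by rewrite powRM//; apply: ler_wpM2l => //; exact: powR_ge0.
have -> : p = (p - 1) + 1 by rewrite subrK.
have ub : 0 < `|u| * b by apply: le_lt_trans large; exact: powR_ge0.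
rewrite powRD ?(gt_eqF ub) ?implybT// (powRr1 (ltW ub)).
rewrite ler_pM2r//.
have := @ge0_ler_powR _ (p - 1) (ltW p10) (C `^ (p - 1)^-1) (`|u| * b).
rewrite !nnegrE powR_ge0 ub0 (ltW large) -powRrM.
rewrite (mulVf (lt0r_neq0 p10)) (powRr1 (ltW C0)).
by move=> /(_ isT isT isT).
Qed.

End young.

(** * Real-valued integrals *)

Section integrable_tools.
Context d (X : measurableType d) (R : realType).
Variable mu : {measure set X -> \bar R}.
Implicit Types (D : set X) (f g h : X -> R).

Lemma integrable_mul_bounded D f h (M : R) : measurable D ->
  mu.-integrable D (EFin \o f) -> measurable_fun D h ->
  (forall x, D x -> `|h x| <= M) ->
  mu.-integrable D (EFin \o (fun x => f x * h x)).
Proof.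
move=> mD fi mh hM.
have := integrableMl mD fi mh; apply.
exists M; split; first exact: num_real.
by move=> N MN x Dx; exact: le_trans (hM x Dx) (ltW MN).
Qed.

Lemma integrable_cst D (r : R) : measurable D -> (mu D < +oo)%E ->
  mu.-integrable D (EFin \o (fun=> r)).
Proof.
move=> mD Doo; apply: measurable_bounded_integrable => //.
by exists `|r|; split; [exact: num_real|move=> N MN x Dx; exact: ltW].
Qed.

Lemma Rintegral_support D Q f :
  Q `<=` D -> (forall x, D x -> ~ Q x -> f x = 0) ->
  \int[mu]_(x in D) f x = \int[mu]_(x in Q) f x.
Proof.
move=> QD f0; rewrite [LHS]Rintegral_mkcond [RHS]Rintegral_mkcond.
congr (Rintegral _ _ _); apply/funext => x; rewrite !patchE.
case: ifPn => [/set_mem Dx|]; case: ifPn => [/set_mem Qx|] //.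
  by rewrite notin_setE => Qx; exact: f0.
by rewrite notin_setE => Dx; case: Dx; exact: QD.
Qed.

Lemma Rintegral_ae_eq D f g : measurable D ->
  measurable_fun D f -> measurable_fun D g ->
  {ae mu, forall x, D x -> f x = g x} ->
  \int[mu]_(x in D) f x = \int[mu]_(x in D) g x.
Proof.
move=> mD mf mg fg; congr fine; apply: ae_eq_integral => //.
- exact/measurable_EFinP.
- exact/measurable_EFinP.
- by apply: filterS fg => x + Dx => /(_ Dx) ->.
Qed.

Lemma Rintegral_ae_ge0 D f : measurable D -> measurable_fun D f ->
  {ae mu, forall x, D x -> 0 <= f x} -> 0 <= \int[mu]_(x in D) f x.
Proof.
move=> mD mf f0; rewrite (@Rintegral_ae_eq _ _ (fun x => Num.max (f x) 0))//.
- by apply: Rintegral_ge0 => x _; rewrite le_max lexx orbT.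
- exact: measurable_maxr.
- by apply: filterS f0 => x + Dx => /(_ Dx) fx; rewrite max_l.
Qed.

End integrable_tools.

(** * Integrability on the support of the cutoff *)

Section cylinder.
Context {R : realType} {n : nat}.
Variables (T : R) (a : 'I_n -> R).
Hypotheses (T_gt0 : 0 < T) (a_gt0 : forall i, 0 < a i).
Local Notation mu := (@lebesgue_row R n).
Local Notation nu := (@spacetime_measure R n).
Implicit Types (w : 'rV[R]_n -> R).

Definition cylinder : set (measurableTypeR R * 'rV[R]_n) :=
  `[0, T]%classic `*` box a.

Lemma cylinder_measurable : measurable cylinder.
Proof.
by apply: measurableX; [exact: measurable_itv|exact: box_measurable].
Qed.

Lemma cylinder_slab : cylinder `<=` slab T.
Proof. by move=> z [zT _]. Qed.

Lemma slab_measurable :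
  measurable (slab T : set (measurableTypeR R * 'rV[R]_n)).
Proof. by apply: measurableX => //; exact: measurable_itv. Qed.

Lemma lebesgue_time_itv (r : R) : 0 < r ->
  lebesgue_measure (`[0, r]%classic : set (measurableTypeR R)) = r%:E.
Proof. by move=> r0; rewrite lebesgue_measure_itv/= lte_fin r0 sube0. Qed.

Lemma cylinder_volume : nu cylinder = (T * \prod_(i < n) (2 * a i))%:E.
Proof.
rewrite /spacetime_measure product_measure1E//.
- rewrite [X in (_ * X)%E](box_volume a_gt0).
  by rewrite [X in (X * _)%E]lebesgue_time_itv.
- exact: box_measurable.
Qed.

Lemma locally_L1_box w : locally_L1 w -> mu.-integrable (box a) (EFin \o w).
Proof.
move=> [mw wK]; apply/integrableP; split.
  by apply/measurable_EFinP; exact: measurable_funTS.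
by apply: wK; exact: box_compact.
Qed.

Lemma integrable_space_cylinder w : measurable_fun setT w ->
  mu.-integrable (box a) (EFin \o w) ->
  nu.-integrable cylinder (EFin \o (fun z => w z.2)).
Proof.
move=> mw /integrableP[_ iw]; apply/integrableP; split.
  apply/measurable_EFinP; apply: measurable_funTS.
  exact: (measurableT_comp mw).
rewrite /cylinder (@integral_cylinder _ _ _ _ (fun x => `|w x|))//.
- rewrite [X in (X * _)%E]lebesgue_time_itv//.
  by rewrite lte_mul_pinfty ?lee_fin ?(ltW T_gt0).
- exact: box_measurable.
- exact: (measurableT_comp (@normr_measurable R setT) mw).
Qed.

Lemma integrable_solution_cylinder p (u : R * 'rV[R]_n -> R) : 1 < p ->
  locally_Lp_halfspace p u ->
  nu.-integrable cylinder (EFin \o (fun z => `|u z| `^ p)) /\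
  nu.-integrable cylinder (EFin \o u).
Proof.
move=> p1 [mu_ uK].
have QD : cylinder `<=` `[0, +oo[%classic `*` setT.
  by move=> z [/= + _]; rewrite !in_itv/= => /andP[-> _].
have mD : measurable
    (`[0, +oo[%classic `*` setT : set (measurableTypeR R * 'rV[R]_n)).
  by apply: measurableX => //; exact: measurable_itv.
have muQ : measurable_fun cylinder u by exact: measurable_funS mu_.
have mupQ : measurable_fun cylinder (fun z => `|u z| `^ p).
  apply: (measurableT_comp (measurable_powR p)).
  exact: measurableT_comp.
have ip : nu.-integrable cylinder (EFin \o (fun z => `|u z| `^ p)).
  apply/integrableP; split; first exact/measurable_EFinP.
  rewrite (_ : integral _ _ _ = \int[nu]_(z in cylinder) (`|u z| `^ p)%:E)%E.
    apply: uK => //; apply: compact_setX; first exact: segment_compact.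
    exact: box_compact.
  by apply: eq_integral => z _ /=; rewrite ger0_norm// powR_ge0.
split => //.
have i1 : nu.-integrable cylinder (EFin \o (fun=> 1 : R)).
  apply: integrable_cst; first exact: cylinder_measurable.
  by rewrite [X in (X < _)%E]cylinder_volume ltry.
apply: le_integrable (integrableD cylinder_measurable i1 ip).
- exact: cylinder_measurable.
- exact/measurable_EFinP.
move=> z _ /=; rewrite lee_fin [leRHS]ger0_norm ?addr_ge0 ?powR_ge0//.
have [u1|u1] := leP `|u z| 1.
  by rewrite (le_trans u1)// lerDl powR_ge0.
apply: (@le_trans _ _ (`|u z| `^ p)); last by rewrite lerDr.
by rewrite -[leLHS]powRr1// ler_powR ?(ltW u1) ?(ltW p1).
Qed.

End cylinder.

(** * The upper bound for the weighted mass *)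

Section mass_upper_bound.
Context {R : realType} {n : nat}.
Variables (T : R) (a : 'I_n -> R) (p : R) (k : nat).
Hypotheses (T_gt0 : 0 < T) (a_gt0 : forall i, 0 < a i).
(* [kp] says that [b ^+ (k.+1 * p)] is at most [b ^+ k.+3] for [0 <= b <= 1]. *)
Hypotheses (p_gt1 : 1 < p) (kp : k.+3%:R <= k.+1%:R * p).
Variables (w u0 : 'rV[R]_n -> R) (u : R * 'rV[R]_n -> R).
Local Notation mu := (@lebesgue_row R n).
Local Notation nu := (@spacetime_measure R n).
Hypotheses (wL1 : locally_L1 w) (u0L1 : locally_L1 u0).
Hypothesis u0_ge0 : {ae mu, forall x, 0 <= u0 x}.
Hypothesis u_sol : global_weak_solution p w u0 u.

Local Notation Q := (cylinder T a).
Local Notation phi := (cutoff T a k.+3).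

(** The constant [K] in [|phi_t + Lap phi| <= K * cutoff T a k.+1]. *)
Definition heat_constant : R :=
  k.+3%:R / T + \sum_(j < n) laplacian_constant k / a j ^+ 2.

Let time_in (z : R * 'rV[R]_n) : slab T z -> 0 <= z.1 <= T.
Proof. by case=> /=; rewrite in_itv. Qed.

Let cutoff_off z m : slab T z -> ~ Q z -> cutoff T a m.+1 z = 0.
Proof. by move=> [zT _] zQ; apply: cutoff_out => // zb; apply: zQ. Qed.

Let cutoff_norm_le1 z m : slab T z -> `|cutoff T a m z| <= 1.
Proof.
by move=> /time_in/(cutoff_itv a T_gt0 m)/andP[c0 c1]; rewrite ger0_norm.
Qed.

Let laplacian_sum_ge0 : 0 <= \sum_(j < n) laplacian_constant k / a j ^+ 2.
Proof. by apply: sumr_ge0 => j _; rewrite divr_ge0 ?sqr_ge0 ?mulr_ge0. Qed.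

Lemma heat_constant_gt0 : 0 < heat_constant.
Proof. by rewrite ltr_wpDr// divr_gt0. Qed.

Let pointwise z : Q z ->
  w z.2 * phi z - heat_constant `^ (p / (p - 1)) <=
  (`|u z| `^ p + w z.2) * phi z + u z * time_derivative T phi z +
    u z * laplacian phi z.
Proof.
move=> /cylinder_slab zT.
have /andP[b0 b1] := cutoff_itv a T_gt0 k.+1 (time_in zT).
have bphi : cutoff T a k.+1 z `^ p <= phi z.
  rewrite 2!(cutoffX _ _ k.+1, cutoffX _ _ k.+3).
  have /andP[c0 c1] := cutoff_itv a T_gt0 1 (time_in zT).
  rewrite -!powR_mulrn// -powRrM.
  have [->|c] := eqVneq (cutoff T a 1 z) 0.
    by rewrite !powR0// ?mulf_neq0 ?pnatr_eq0// gt_eqF// (lt_trans _ p_gt1).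
  by apply: ger_powR => //; rewrite lt_neqAle eq_sym c c0.
have H : `|time_derivative T phi z + laplacian phi z| <=
    heat_constant * cutoff T a k.+1 z.
  apply: (le_trans (ler_normD _ _)); rewrite mulrDl; apply: lerD.
    exact: time_derivative_cutoff_le.
  exact: laplacian_cutoff_le.
have := young_absorption (u z) p_gt1 heat_constant_gt0 b0 bphi H.
rewrite mulrDr mulrDl; lra.
Qed.

Lemma mass_upper_bound :
  \int[nu]_(z in Q) (w z.2 * phi z) <=
  heat_constant `^ (p / (p - 1)) * (T * \prod_(i < n) (2 * a i)).
Proof.
case: u_sol => uLp _ /(_ T T_gt0 phi) weak.
have {}weak := weak (test_function_cutoff T_gt0 a_gt0 k).
(* [A - B] integrates the left-hand side of [pointwise]; [I0] comes from the
   initial datum, [I1], [I2], [I3] from the equation. *)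
have balance (A B I0 I1 I2 I3 : R) : I1 + I0 = - I2 - I3 -> 0 <= I0 ->
    A - B <= I1 + I2 + I3 -> A <= B by lra.
move: weak; rewrite /weak_formulation.
have mQ := cylinder_measurable T a.
have QS := @cylinder_slab _ _ T a.
have mphi : measurable_fun Q phi.
  by apply: measurable_funTS; exact: measurable_cutoff.
have phi1 z : Q z -> `|phi z| <= 1.
  by move=> /QS; exact: cutoff_norm_le1.
have mt : measurable_fun Q (time_derivative T phi).
  apply: measurable_funS QS (measurable_time_derivative_cutoff _ _ _) => //.
  exact: slab_measurable.
have t1 z : Q z -> `|time_derivative T phi z| <= k.+3%:R / T.
  move=> /QS zS; apply: (le_trans (time_derivative_cutoff_le a T_gt0 k zS)).
  apply: ler_piMr; first by rewrite divr_ge0// ltW.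
  exact: le_trans (ler_norm _) (cutoff_norm_le1 _ zS).
have ml : measurable_fun Q (laplacian phi).
  by apply: measurable_funTS; exact: measurable_laplacian_cutoff.
have l1 z : Q z ->
    `|laplacian phi z| <= \sum_(j < n) laplacian_constant k / a j ^+ 2.
  move=> /QS zS; apply: (le_trans (laplacian_cutoff_le T_gt0 a_gt0 k zS)).
  apply: ler_piMr => //.
  exact: le_trans (ler_norm _) (cutoff_norm_le1 _ zS).
have [iup iu] := integrable_solution_cylinder T_gt0 a_gt0 p_gt1 uLp.
have iw := integrable_space_cylinder T_gt0 (proj1 wL1) (locally_L1_box a wL1).
have i1 : nu.-integrable Q (EFin \o (fun z => (`|u z| `^ p + w z.2) * phi z)).
  apply: integrable_mul_bounded => //; last exact: phi1.
  exact: (integrableD mQ iup iw).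
have i2 := integrable_mul_bounded mQ iu mt t1.
have i3 := integrable_mul_bounded mQ iu ml l1.
have iwp := integrable_mul_bounded mQ iw mphi phi1.
have Qoo : (nu Q < +oo)%E by rewrite [X in (X < _)%E]cylinder_volume// ltry.
have ic := integrable_cst (heat_constant `^ (p / (p - 1))) mQ Qoo.
rewrite (Rintegral_support _ QS); last first.
  by move=> z zS zQ; rewrite cutoff_off ?mulr0.
rewrite (Rintegral_support _ QS); last first.
  move=> z zS zQ; have := time_derivative_cutoff_le a T_gt0 k zS.
  by rewrite cutoff_off// mulr0 normr_le0 => /eqP ->; rewrite mulr0.
rewrite (Rintegral_support _ QS); last first.
  move=> z zS zQ; have := laplacian_cutoff_le T_gt0 a_gt0 k zS.
  by rewrite cutoff_off// mulr0 normr_le0 => /eqP ->; rewrite mulr0.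
move=> weak.
have u0pos : 0 <= \int[mu]_x (u0 x * phi (0, x)).
  have z0 (x : 'rV[R]_n) : slab T (0, x).
    by split => //=; rewrite in_itv/= lexx ltW.
  apply: Rintegral_ae_ge0 => //.
    apply: measurable_funM; first by case: u0L1.
    have mc := measurable_cutoff T a k.+3.
    have m0 : measurable_fun setT
        (fun x : 'rV[R]_n => (0 : measurableTypeR R, x)).
      exact: measurable_fun_pair.
    exact: (measurableT_comp mc m0).
  apply: filterS u0_ge0 => x u0x _; apply: mulr_ge0 => //.
  by have /andP[] := cutoff_itv a T_gt0 k.+3 (time_in (z0 x)).
have i12 : nu.-integrable Q (EFin \o (fun z =>
    (`|u z| `^ p + w z.2) * phi z + u z * time_derivative T phi z)).
  exact: (integrableD mQ i1 i2).
have i123 : nu.-integrable Q (EFin \o (fun z =>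
    (`|u z| `^ p + w z.2) * phi z + u z * time_derivative T phi z +
    u z * laplacian phi z)) by exact: (integrableD mQ i12 i3).
have iB : nu.-integrable Q (EFin \o (fun z =>
    w z.2 * phi z - heat_constant `^ (p / (p - 1)))).
  exact: (integrableB mQ iwp ic).
have := le_Rintegral mQ iB i123 pointwise.
rewrite (RintegralB mQ iwp ic) (RintegralD mQ i12 i3) (RintegralD mQ i1 i2).
rewrite Rintegral_cst// [fine _](_ : _ = T * \prod_(i < n) (2 * a i)).
  exact: balance weak u0pos.
by rewrite [X in fine X]cylinder_volume.
Qed.

End mass_upper_bound.

(** * The lower bound for the weighted mass *)

Section lower.
Context {R : realType} {n : nat}.
Variables (T : R) (a : 'I_n -> R) (k : nat).
Hypotheses (T_gt0 : 0 < T) (a_gt0 : forall i, 0 < a i).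
Variable (w : 'rV[R]_n -> R).
Local Notation mu := (@lebesgue_row R n).
Local Notation nu := (@spacetime_measure R n).
Hypotheses (wL1 : locally_L1 w) (w_ge0 : {ae mu, forall x, 0 <= w x}).

(* The source is only nonnegative almost everywhere; its positive part is
   nonnegative everywhere and has the same integrals. *)
Let wp x := Num.max (w x) 0.

Let wp_ge0 x : 0 <= wp x. Proof. by rewrite le_max lexx orbT. Qed.

Let wp_ae : {ae mu, forall x, w x = wp x}.
Proof. by apply: filterS w_ge0 => x wx; rewrite /wp max_l. Qed.

Let mwp : measurable_fun setT wp.
Proof. by apply: measurable_maxr => //; case: wL1. Qed.

Let wp_integrable (b : 'I_n -> R) : mu.-integrable (box b) (EFin \o wp).
Proof.
apply: le_integrable (locally_L1_box b wL1); first exact: box_measurable.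
- by apply/measurable_EFinP; exact: measurable_funTS.
move=> x _ /=; rewrite lee_fin (ger0_norm (wp_ge0 x)) /wp.
by rewrite ge_max normr_ge0 ler_norm.
Qed.

(** A lower bound for the cutoff on the first half of the time interval and the
    box of half the widths, see [cutoff_ge]. *)
Definition cutoff_min m : R := 2^-1 ^+ m * \prod_(i < n) (3 / 4) ^+ m.

Lemma cutoff_min_gt0 m : 0 < cutoff_min m.
Proof.
apply: mulr_gt0; first by rewrite exprn_gt0.
by apply: prodr_gt0 => i _; rewrite exprn_gt0// divr_gt0.
Qed.

Let half i : R := a i / 2.
Let half_gt0 i : 0 < half i. Proof. by rewrite divr_gt0. Qed.
Let T2_gt0 : 0 < T / 2. Proof. by rewrite divr_gt0. Qed.

Lemma mass_lower_bound :
  cutoff_min k.+3 * (T / 2 * \int[mu]_(x in box half) w x) <=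
  \int[nu]_(z in cylinder T a) (w z.2 * cutoff T a k.+3 z).
Proof.
have [mw _] := wL1.
have mQ := cylinder_measurable T a.
have mH := cylinder_measurable (T / 2) half.
have mwp2 : measurable_fun
    [set: measurableTypeR R * 'rV[R]_n] (fun z => wp z.2).
  exact: (measurableT_comp mwp).
have mw2 : measurable_fun
    [set: measurableTypeR R * 'rV[R]_n] (fun z => w z.2).
  exact: (measurableT_comp mw).
have mc := measurable_cutoff T a k.+3.
have HQ : cylinder (T / 2) half `<=` cylinder T a.
  move=> z [/= z1 z2]; split => /=.
    move: z1; rewrite !in_itv/= => /andP[-> /= zT]; apply: (le_trans zT).
    by rewrite ler_pdivrMr// ler_peMr ?ler1n// ltW.
  move=> i; apply: (le_trans (z2 i)).
  by rewrite /half ler_pdivrMr// ler_peMr ?ler1n// ltW.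
have phi01 z : cylinder T a z -> 0 <= cutoff T a k.+3 z <= 1.
  by move=> [/= + _]; rewrite in_itv/=; exact: cutoff_itv.
rewrite (@Rintegral_ae_eq _ _ _ _ _ w wp)//; last 4 first.
- exact: box_measurable.
- exact: measurable_funTS.
- exact: measurable_funTS.
- by apply: filterS wp_ae.
have -> : \int[nu]_(z in cylinder T a) (w z.2 * cutoff T a k.+3 z) =
    \int[nu]_(z in cylinder T a) (wp z.2 * cutoff T a k.+3 z).
  apply: Rintegral_ae_eq => //.
  - by apply: measurable_funTS; exact: measurable_funM.
  - by apply: measurable_funTS; exact: measurable_funM.
  - by apply: filterS (ae_spacetime wp_ae) => z ->.
have iH := integrable_space_cylinder T2_gt0 mwp (wp_integrable half).
have iQ := integrable_space_cylinder T_gt0 mwp (wp_integrable a).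
have iQc : nu.-integrable (cylinder T a)
    (EFin \o (fun z => wp z.2 * cutoff T a k.+3 z)).
  apply: (integrable_mul_bounded (M := 1)) => //; first exact: measurable_funTS.
  by move=> z /phi01/andP[c0 c1]; rewrite ger0_norm.
have -> : T / 2 * \int[mu]_(x in box half) wp x =
    \int[nu]_(z in cylinder (T / 2) half) wp z.2.
  rewrite /Rintegral /cylinder (@integral_cylinder _ _ _ _ wp)//; last first.
    exact: box_measurable.
  rewrite [X in fine (X * _)%E]lebesgue_time_itv// fineM//.
  have := integrable_fin_num (box_measurable half) (wp_integrable half).
  exact.
rewrite -RintegralZl//.
have iHc : nu.-integrable (cylinder (T / 2) half)
    (EFin \o (fun z => wp z.2 * cutoff T a k.+3 z)).
  exact: integrableS iQc.
apply: (@le_trans _ _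
  (\int[nu]_(z in cylinder (T / 2) half) (wp z.2 * cutoff T a k.+3 z))).
  apply: le_Rintegral => //.
    exact: (integrableZl mH _ iH).
  move=> z [/= z1 z2]; rewrite mulrC; apply: ler_wpM2l => //.
  by apply: cutoff_ge => //; move: z1; rewrite in_itv.
apply: fine_le.
- exact: integrable_fin_num iHc.
- exact: integrable_fin_num iQc.
apply: ge0_subset_integral => //.
- exact: (measurable_int _ iQc).
by move=> z /phi01/andP[c0 _]; rewrite lee_fin mulr_ge0.
Qed.

End lower.

(** * Growth of regularly varying functions *)

Section growth.
Context {R : realType}.

Lemma expr_ge_linear (b : R) n : 1 <= b -> n%:R * (b - 1) <= b ^+ n.
Proof.
move=> b1; apply: (@le_trans _ _ (1 + n%:R * (b - 1))); first by rewrite lerDr.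
elim: n => [|n ih]; first by rewrite mul0r addr0 expr0.
have bn : 1 <= b ^+ n by rewrite exprn_ege1.
rewrite exprSr -natr1.
have : 0 <= (b ^+ n - 1) * (b - 1) by rewrite mulr_ge0 ?subr_ge0.
nra.
Qed.

Lemma powR_gt1 (b d : R) : 1 < b -> 0 < d -> 1 < b `^ d.
Proof.
move=> b1 d0; have := @gt0_ltr_powR _ _ d0 1 b.
by rewrite !nnegrE ler01 (ltW (lt_trans ltr01 b1)) powR1 => /(_ isT isT b1).
Qed.

(** For [e < s < rho] the limit at the ratio 2 yields
    [V (2 * t) >= 2 `^ s * V t] for large [t], hence geometric growth with
    ratio [2 `^ s] along [2 ^+ n * t0], which beats the ratio [2 `^ e]. *)
Lemma regularly_varying_not_dominated (rho e C : R) (V : R -> R) :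
  regularly_varying rho V -> e < rho ->
  ~ (forall r, 1 <= r -> V r <= C * r `^ e).
Proof.
move=> [A [A0 _ V0 Vlim]] erho VC.
pose s := (e + rho) / 2.
have es : e < s by rewrite /s; lra.
have srho : s < rho by rewrite /s; lra.
have two1 : 1 < 2 :> R by rewrite ltr1n.
have pow2 : 2 `^ s < 2 `^ rho :> R.
  rewrite -[X in _ < 2 `^ X](subrK s) powRD ?pnatr_eq0 ?implybT//.
  by rewrite ltr_pMl ?powR_gt0// powR_gt1// subr_gt0.
have [M [_ MV]] := cvgr_gt _ (Vlim 2 (ltr0n _ 2)) _ pow2.
pose t0 := Num.max (M + 1) (Num.max A 1).
have t0M : M < t0 by rewrite /t0 lt_max ltrDl ltr01.
have t0A : A <= t0 by rewrite /t0 !le_max lexx orbT.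
have t01 : 1 <= t0 by rewrite /t0 !le_max lexx !orbT.
have t00 : 0 < t0 by apply: lt_le_trans t01.
have grow n : (2 `^ s) ^+ n * V t0 <= V (2 ^+ n * t0).
  elim: n => [|n ih]; first by rewrite !expr0 !mul1r.
  set t := 2 ^+ n * t0.
  have tt0 : t0 <= t by rewrite ler_peMl ?exprn_ege1 ?ltW.
  have := MV t (lt_le_trans t0M tt0).
  have Vt : 0 < V t by apply: V0; apply: le_trans tt0.
  rewrite ltr_pdivlMr// => /ltW H.
  rewrite exprS -mulrA (_ : 2 ^+ n.+1 * t0 = t * 2); last first.
    by rewrite /t exprS; ring.
  apply: le_trans H; apply: ler_wpM2l => //; exact: powR_ge0.
pose b : R := 2 `^ (s - e).
have b1 : 1 < b.
  by rewrite powR_gt1// subr_gt0.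
have bound n : b ^+ n * V t0 <= C * t0 `^ e.
  have P1 : 1 <= 2 ^+ n * t0 by rewrite mulr_ege1// exprn_ege1// ltW.
  have := le_trans (grow n) (VC _ P1).
  rewrite powRM ?exprn_ge0 ?(ltW t00)//.
  have -> : (2 ^+ n) `^ e = (2 `^ e) ^+ n :> R.
    by rewrite -[2 ^+ n]powR_mulrn// powRAC powR_mulrn// powR_ge0.
  rewrite (_ : 2 `^ s = b * 2 `^ e); last first.
    by rewrite /b -powRD ?subrK// pnatr_eq0 implybT.
  move=> H; have Pn : 0 < (2 `^ e) ^+ n :> R by rewrite exprn_gt0// powR_gt0.
  rewrite -(ler_pM2l Pn) [leLHS](_ : _ = (b * 2 `^ e) ^+ n * V t0); last first.
    by rewrite exprMn; ring.
  by rewrite [leRHS](_ : _ = C * ((2 `^ e) ^+ n * t0 `^ e)); last by ring.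
have VT := V0 _ t0A.
have [n nP] : exists n : nat, C * t0 `^ e / V t0 / (b - 1) < n%:R.
  by exists (Num.truncn (C * t0 `^ e / V t0 / (b - 1))).+1; exact: truncnS_gt.
move: nP; rewrite ltNge => /negP; apply.
rewrite ler_pdivlMr ?subr_gt0// ler_pdivlMr//.
apply: le_trans (bound n); apply: ler_wpM2r; first exact: ltW.
exact/expr_ge_linear/ltW.
Qed.

Lemma powR_sumr (I : finType) (r : R) (f : I -> R) : 0 < r ->
  \prod_(i in I) r `^ f i = r `^ (\sum_(i in I) f i).
Proof.
move=> r0.
have rD : {morph powR r : x y / x + y >-> x * y}.
  by move=> x y; rewrite powRD// (gt_eqF r0) implybT.
by rewrite (big_morph _ rD (powRr0 r)).
Qed.

End growth.

(** * Nonexistence *)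

Section mass_bound.
Context {R : realType} {N : nat}.
Variables (alpha : 'rV[R]_N.+1) (alpha_gt0 : forall j, 0 < alpha 0 j).

Lemma lambda_min_le j : lambda_min alpha <= alpha 0 j.
Proof. exact: bigmin_le. Qed.

Lemma lambda_min_gt0 : 0 < lambda_min alpha.
Proof. by apply: lt_bigmin. Qed.

(** The time scale [r `^ (2 * lam)] balances the two parts of [heat_constant]:
    for [r >= 1] the direction of the smallest [alpha_j] has the largest
    [(a j) ^- 2], namely a multiple of [r `^ (- (2 * lam))]. *)
Lemma operator_mass_le (p : R) (w u0 : 'rV[R]_N.+1 -> R) u :
  1 < p -> locally_L1 w -> {ae @lebesgue_row R N.+1, forall x, 0 <= w x} ->
  locally_L1 u0 -> {ae @lebesgue_row R N.+1, forall x, 0 <= u0 x} ->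
  global_weak_solution p w u0 u ->
  exists C, forall r, 1 <= r -> operator_mass alpha w r <=
    C * r `^ (\tr (diag_mx alpha) - 2 * lambda_min alpha * (p / (p - 1))).
Proof.
move=> p1 wL1 w0 u0L1 u00 sol.
have p10 : 0 < p - 1 by rewrite subr_gt0.
have [k kp] : exists k : nat, k.+3%:R <= k.+1%:R * p.
  (* The inequality reads [2 <= k.+1%:R * (p - 1)]. *)
  exists (Num.truncn (2 / (p - 1))).
  have := ltW (truncnS_gt (2 / (p - 1))).
  by rewrite ler_pdivrMr// => H; rewrite -addn2 natrD; lra.
set lam := lambda_min alpha; set q := p / (p - 1).
pose c := @cutoff_min R N.+1 k.+3.
have c0 : 0 < c by exact: cutoff_min_gt0.
pose B : R := k.+3%:R + N.+1%:R * laplacian_constant k.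
have B0 : 0 <= B by rewrite addr_ge0// !mulr_ge0.
exists (2 / c * (B `^ q * 4 ^+ N.+1)) => r r1.
have r0 : 0 < r by apply: lt_le_trans r1.
pose T := r `^ (2 * lam).
(* The factor 2 makes the box of half the widths equal to the operator box. *)
pose a i : R := 2 * r `^ (alpha 0 i).
have T0 : 0 < T by exact: powR_gt0.
have a0 i : 0 < a i by rewrite mulr_gt0// powR_gt0.
have upper := mass_upper_bound T0 a0 p1 kp wL1 u0L1 u00 sol.
have := le_trans (mass_lower_bound k T0 a0 wL1 w0) upper.
rewrite (_ : box _ = operator_box alpha r); last first.
  apply/seteqP; split => x /= xa j; have := xa j.
    by rewrite /a mulrAC divff// mul1r.
  by rewrite /a mulrAC divff// mul1r.
rewrite -/(operator_mass alpha w r).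
have K : heat_constant (n := N.+1) T a k <= B * r `^ (- (2 * lam)).
  rewrite /heat_constant /B [leRHS]mulrDl; apply: lerD; first by rewrite powRN.
  apply: (@le_trans _ _
    (\sum_(j < N.+1) laplacian_constant k * r `^ (- (2 * lam)))).
    apply: ler_sum => j _; apply: ler_wpM2l.
      by rewrite !mulr_ge0.
    rewrite /a exprMn powRN lef_pV2 ?posrE ?powR_gt0//; last first.
      by rewrite mulr_gt0 ?exprn_gt0 ?powR_gt0.
    apply: (@le_trans _ _ (r `^ alpha 0 j ^+ 2)); last first.
      by rewrite ler_peMl ?exprn_ge0 ?powR_ge0// expr2; lra.
    rewrite -powR_mulrn ?powR_ge0// -powRrM ler_powR// mulrC.
    by rewrite ler_pM2r//; exact: lambda_min_le.
  by rewrite sumr_const card_ord -[leLHS]mulr_natl mulrA.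
have Kq : heat_constant (n := N.+1) T a k `^ q <=
    B `^ q * r `^ (- (2 * lam * q)).
  rewrite -mulNr [r `^ _]powRrM -powRM ?powR_ge0//.
  apply: ge0_ler_powR => //; rewrite ?nnegrE.
  - by rewrite divr_ge0// ltW// (lt_trans ltr01).
  - exact/ltW/heat_constant_gt0.
  - by rewrite mulr_ge0// powR_ge0.
have V : \prod_(i < N.+1) (2 * a i) = 4 ^+ N.+1 * r `^ \tr (diag_mx alpha).
  rewrite mxtrace_diag -powR_sumr//.
  rewrite (_ : 4 ^+ N.+1 = \prod_(i < N.+1) 4); last first.
    by rewrite prodr_const card_ord.
  by rewrite -big_split/=; apply: eq_bigr => i _; rewrite /a mulrA -natrM.
rewrite V -/c => H.
set F := operator_mass alpha w r in H *.
have : c * (T / 2 * F) <= B `^ q * r `^ (- (2 * lam * q)) *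
    (T * (4 ^+ N.+1 * r `^ \tr (diag_mx alpha))).
  apply: (le_trans H); apply: ler_wpM2r => //.
  by rewrite !mulr_ge0 ?powR_ge0 ?exprn_ge0// ltW.
rewrite powRD; last by rewrite (gt_eqF r0) implybT.
move: (r `^ (- _)) (r `^ \tr _) => x y.
rewrite [leLHS](_ : _ = T * (c / 2 * F)); last by ring.
rewrite [leRHS](_ : _ = T * (B `^ q * x * 4 ^+ N.+1 * y)); last by ring.
rewrite ler_pM2l// mulrC -ler_pdivlMr ?divr_gt0// invf_div.
have -> : B `^ q * x * 4 ^+ N.+1 * y * (2 / c) =
  2 / c * (B `^ q * 4 ^+ N.+1) * (y * x) by ring.
exact.
Qed.

End mass_bound.

Unset Implicit Arguments.
Set Strict Implicit.

Theorem theorem7p1 (R : realType) (N : nat) (alpha : 'rV[R]_N.+1)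
    (w : 'rV[R]_N.+1 -> R) (gammaE : R) (L : R -> R)
    (alpha_gt0 : forall j, 0 < alpha 0 j)
    (w_L1loc : locally_L1 w)
    (w_ge0 : {ae @lebesgue_row R N.+1, forall x, 0 <= w x})
    (gammaE_itv : 0 < gammaE < \tr (diag_mx alpha))
    (F_RV : regularly_varying gammaE (operator_mass alpha w))
    (L_RV : regularly_varying 0 L)
    (F_eq : \forall r \near +oo%R,
       operator_mass alpha w r = r `^ gammaE * L r) :
  let q := \tr (diag_mx alpha) - gammaE in
  let pF := critical_exponent q (lambda_min alpha) in
  (forall p : R, 1 < p -> (p%:E < pF)%E -> no_global_weak_solution p w) /\
  (2 * lambda_min alpha < q -> L r @[r --> +oo%R] --> +oo%R ->
   forall p : R, p%:E = pF -> no_global_weak_solution p w).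
Proof.
move=> q pF.
have lam0 := lambda_min_gt0 alpha_gt0.
split.
  move=> p p1 ppF u0 u0L1 u00 [u sol].
  have [C FC] := operator_mass_le alpha p1 w_L1loc w_ge0 u0L1 u00 sol.
  apply: (regularly_varying_not_dominated F_RV _ FC).
  have p10 : 0 < p - 1 by rewrite subr_gt0.
  rewrite ltrBlDr -ltrBlDl -/q mulrA ltr_pdivlMr//.
  move: ppF; rewrite /pF /critical_exponent; case: ifPn => [lamq|].
    rewrite lte_fin ltr_pdivlMr ?subr_gt0// => H; lra.
  rewrite -leNgt => qlam _.
  have : (2 * lambda_min alpha - q) * p >= 0.
    by rewrite mulr_ge0 ?subr_ge0// ltW// (lt_trans ltr01).
  have q0 : 0 < q by rewrite subr_gt0; case/andP: gammaE_itv.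
  lra.
move=> lamq Loo p; rewrite /pF /critical_exponent lamq => -[pE].
move=> u0 u0L1 u00 [u sol].
have q2 : 0 < q - 2 * lambda_min alpha by rewrite subr_gt0.
have p1 : 1 < p by rewrite pE ltr_pdivlMr// mul1r gtrBl mulr_gt0.
have [C FC] := operator_mass_le alpha p1 w_L1loc w_ge0 u0L1 u00 sol.
have e : \tr (diag_mx alpha) - 2 * lambda_min alpha * (p / (p - 1)) = gammaE.
  have -> : p / (p - 1) = q / (2 * lambda_min alpha).
    by rewrite pE; field; rewrite !gt_eqF//=; lra.
  by rewrite mulrC divfK ?gt_eqF ?mulr_gt0// /q opprB addrC subrK.
rewrite e in FC.
near (pinfty_nbhs R) => r.
have r1 : 1 <= r by near: r; apply: nbhs_pinfty_ge; exact: num_real.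
have := FC _ r1.
have -> : operator_mass alpha w r = r `^ gammaE * L r by near: r.
rewrite mulrC ler_pM2r ?powR_gt0 ?(lt_le_trans ltr01 r1)// leNgt.
move=> /negP; apply.
by near: r; exact: cvgry_gt Loo C.
Unshelve. all: by end_near. Qed.
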